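(* Let $(X^{(n)}_k, k\ge 0)_{n\ge 1}$ be a collection of independent random processes on $\mathbb{Z}$ such that for every $n\ge 1$, $X^{(n)}_0=0$ and $X^{(n)}_{k+1}-X^{(n)}_k\in\{-1,+1\}$ for all $k\ge 0$, and such that each $X^{(n)}$ almost surely visits infinitely many sites. Let $(d_n)_{n\ge 0}$ be the right boundary of the associated internal DLA process, let $x_n=\frac{d_n+1}{n+2}$, and let $h_n:[0,1]\to[0,1]$ be given by $$h_n(x)=\mathbb{P}\left[T^{(n)}_{[(n+2)x]}<T^{(n)}_{[(n+2)(x-1)]}\right],$$ all as defined in the context. Assume that there exists a function $h:[0,1]\to[0,1]$ such that for every $x\in[0,1]$, $h_n(x)\to h(x)$ as $n\to\infty$. Then there exists $p\in[0,1]$ such that $x_n\to p$ almost surely as $n\to\infty$. Moreover $p$ is characterized by $h(p-)\ge p\ge h(p+)$, i.e. $p$ is the unique element of $[0,1]$ satisfying these inequalities, where $h(p-)$ and $h(p+)$ denote the left and right limits of $h$ at $p$ (with the conventions $h(0-)=h(0)$ and $h(1+)=h(1)$).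
   Context: Internal DLA right boundary: $d_0=0$, and for all $n\ge 0$, $d_{n+1}=d_n+1$ if $X^{(n+1)}$ hits the site $d_n+1$ before the site $d_n-n-1$; otherwise $d_{n+1}=d_n$. (The assumption that the processes visit a.s. infinitely many sites ensures that $d_n$ is a.s. well defined for all $n$.) For $x\in\mathbb{Z}$, $T^{(n)}_x=\inf\{k\ge 0 : X^{(n)}_k=x\}$, with $\inf\emptyset=+\infty$. For $u\in\mathbb{R}$, $[u]$ denotes the integer with the smallest absolute value among those at distance strictly less than $1$ from $u$ (i.e. truncation toward $0$). Each $h_n$ is nonincreasing with $h_n(0)=1$ and $h_n(1)=0$; hence $h$ is nonincreasing and has one-sided limits. *)

(* Defs.v *)
From HB Require Import structures.
From mathcomp Require Export all_boot all_order all_algebra finmap.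
From mathcomp Require Export all_classical all_reals all_analysis.
Export Order.TTheory GRing.Theory Num.Theory.
Export numFieldNormedType.Exports.

#[export] Set Implicit Arguments.
#[export] Unset Strict Implicit.
#[export] Unset Printing Implicit Defensive.

Local Open Scope classical_set_scope.
Local Open Scope ring_scope.

HB.instance Definition _ := isPointed.Build int 0.

HB.instance Definition _ := @isMeasurable.Build default_measure_display
  int discrete_measurable discrete_measurable0
  discrete_measurableC discrete_measurableU.

(* Truncation toward 0; see truncz_dist and truncz_minimal for the
   characterization as the integer of smallest absolute value at distance
   strictly less than 1. *)
Definition truncz (R : realType) (u : R) : int :=
  if 0 <= u then Num.floor u else Num.ceil u.

Lemma truncz_dist (R : realType) (u : R) : `|u - (truncz u)%:~R| < 1.
Proof.
rewrite /truncz; case: ifP => _.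
  have := floor_itv u; rewrite intrD => /andP[? ?].
  by rewrite ger0_norm ?subr_ge0// ltrBlDr addrC.
have := ceil_itv u; rewrite intrB => /andP[? ?].
by rewrite distrC ger0_norm ?subr_ge0// ltrBlDr addrC -ltrBlDr.
Qed.

Lemma truncz_minimal (R : realType) (u : R) (z : int) :
  `|u - z%:~R| < 1 -> z != truncz u -> `|truncz u| < `|z|.
Proof.
rewrite ltr_norml /truncz => /andP[h1 h2]; case: ifPn => u0 zt.
  have f0 : 0 <= Num.floor u by rewrite floor_ge0.
  have lez : Num.floor u <= z.
    rewrite -ltzD1 -(ltr_int R) intrD.
    by apply: le_lt_trans (floor_le u) _; rewrite -ltrBlDl.
  rewrite ger0_norm// ger0_norm ?(le_trans f0)//.
  by rewrite lt_neqAle eq_sym zt.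
rewrite -ltNge in u0.
have f0 : Num.ceil u <= 0 by rewrite ceil_le_int ltW.
have lez : z <= Num.ceil u.
  rewrite -ltzD1 -(ltr_int R) intrD.
  apply: lt_le_trans (_ : u + 1 <= _); last by rewrite lerD2r ceil_ge.
  by move: h1; rewrite ltrBrDr addrC ltrBlDr.
rewrite ler0_norm// ler0_norm ?(le_trans lez)//.
by rewrite ltrN2 lt_neqAle zt.
Qed.

(* A family of processes on Z; the process X n is the paper's X^(n), which
   only exists for n >= 1, so X 0 is a dummy that is never constrained. *)
Section processes.
Context (d : measure_display) (Omega : measurableType d) (R : realType).
Variables (P : probability Omega R) (X : nat -> nat -> {mfun Omega >-> int}).

Definition process_sigma_algebra (n : nat) : set (set Omega) :=
  <<s \bigcup_k preimage_set_system setT (X n k) measurable >>.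

Definition independent_processes : Prop :=
  forall (J : {fset nat}) (A : nat -> set Omega),
    (forall n, n \in J -> (1 <= n)%N /\ process_sigma_algebra n (A n)) ->
    (P (\bigcap_(n in [set` J]) A n) = \prod_(n <- J) P (A n))%E.

Definition hitting_time (n : nat) (x : int) (w : Omega) : \bar R :=
  ereal_inf [set k%:R%:E | k in [set k : nat | X n k w = x]].

Fixpoint right_boundary (n : nat) (w : Omega) : int :=
  if n is m.+1 then
    let r := right_boundary m w in
    if (hitting_time m.+1 (r + 1) w < hitting_time m.+1 (r - m%:Z - 1) w)%E
    then r + 1 else r
  else 0.

Definition boundary_ratio (n : nat) (w : Omega) : R :=
  ((right_boundary n w)%:~R + 1) / (n%:R + 2).

Definition hit_proba (n : nat) (x : R) : R :=
  fine (P [set w | (hitting_time n (truncz ((n%:R + 2) * x)) w <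
                    hitting_time n (truncz ((n%:R + 2) * (x - 1))) w)%E]).

End processes.

(* One-sided limits of a function on [0, 1], extended by h(0-) = h(0) and
   h(1+) = h(1); for 0 < p <= 1 (resp. 0 <= p < 1) only values of h on [0, 1]
   matter. They are used for nonincreasing h, for which the limits exist. *)
Definition left_limit01 (R : realType) (h : R -> R) (p : R) : R :=
  if p == 0 then h 0 else lim (h x @[x --> p^'-]).

Definition right_limit01 (R : realType) (h : R -> R) (p : R) : R :=
  if p == 1 then h 1 else lim (h x @[x --> p^'+]).

(* Main.v *)
(* Truncation makes the chance of a right step from d_n = a exactly
   h_{n+1}((a + 1) / (n + 2)), so d_n is an inhomogeneous Markov chain. As h is
   nonincreasing there is p with h(c) < c for c > p and h(c) > c for c < p.
   For c > p, the excess Z_n = (d_n + 1) - c (n + 2) thus has nonpositive drift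
   whenever it is positive and n is large, and it has bounded increments; hence
   E[(Z_n^+)^2] = O(n) and E[(Z_n^+)^4] = O(n^2), so P(x_n - c >= e) = O(1/n^2)
   by Markov's inequality and Borel-Cantelli gives limsup x_n <= c almost
   surely. The case c < p is the same up to a sign s = -1. *)

Require Import Defs.
From mathcomp Require Import ring lra zify.

Local Open Scope classical_set_scope.
Local Open Scope ring_scope.

(** * Intermediate values of nearest-neighbour paths *)

Section nearest_neighbour_path.
Variables (f : nat -> int) (f0 : f 0%N = 0).
Hypothesis f_step : forall k, f k.+1 - f k = 1 \/ f k.+1 - f k = -1.

Lemma path_crossing_pos (y : int) (k : nat) :
  0 <= y -> y <= f k -> exists2 j, (j <= k)%N & f j = y.
Proof.
move=> y0; elim: k => [|k IH] yk; first by exists 0%N => //; lia.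
have [/IH[j jk fj]|fky] := boolP (y <= f k); first by exists j => //; lia.
by exists k.+1 => //; have [] := f_step k; lia.
Qed.

Lemma path_crossing_neg (y : int) (k : nat) :
  y <= 0 -> f k <= y -> exists2 j, (j <= k)%N & f j = y.
Proof.
move=> y0; elim: k => [|k IH] yk; first by exists 0%N => //; lia.
have [/IH[j jk fj]|fky] := boolP (f k <= y); first by exists j => //; lia.
by exists k.+1 => //; have [] := f_step k; lia.
Qed.

End nearest_neighbour_path.

(** * Monotonicity and signs of truncation toward 0 *)

Section truncation.
Variable R : realType.
Implicit Types u v : R.

Lemma le_truncz u v : u <= v -> truncz u <= truncz v.
Proof.
rewrite /truncz => uv; case: ifPn => u0.
  by rewrite (le_trans u0 uv); exact: le_floor.
case: ifPn => v0; last exact: le_ceil.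
by rewrite (@le_trans _ _ 0)// ?floor_ge0// ceil_le_int// ltW// ltNge.
Qed.

Lemma truncz_ge0 u : 0 <= u -> 0 <= truncz u.
Proof. by move=> u0; rewrite /truncz u0 floor_ge0. Qed.

Lemma truncz_le0 u : u <= 0 -> truncz u <= 0.
Proof.
by move=> u0; rewrite (le_trans (le_truncz u0))// /truncz lexx floor0.
Qed.

End truncation.

(** * Events comparing two hitting times *)

Section hitting_events.
Context (d : measure_display) (Omega : measurableType d) (R : realType).
Variables (X : nat -> nat -> {mfun Omega >-> int}).

(** A strict inequality forces the left infimum to be finite, even if the right one is infinite, so
    only finitely many times matter. The witness [k] may be any visit to [x], not just the first. *)
Lemma hitting_time_ltP n (x y : int) w :
  (hitting_time R X n x w < hitting_time R X n y w)%E <->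
  exists2 k, X n k w = x & forall j, (j <= k)%N -> X n j w != y.
Proof.
split=> [/ereal_inf_lt[_ [k /= kx <-] kT]|[k kx ky]].
  exists k => // j jk; apply/eqP => jy.
  have : (hitting_time R X n y w <= j%:R%:E)%E.
    by apply: ereal_inf_lbound; exists j.
  by move=> /(lt_le_trans kT); rewrite lte_fin ltr_nat ltnNge jk.
apply: (@le_lt_trans _ _ k%:R%:E); first by apply: ereal_inf_lbound; exists k.
apply: (@lt_le_trans _ _ k.+1%:R%:E); first by rewrite lte_fin ltr_nat.
apply: le_ereal_inf_tmp => _ [j /= jy <-]; rewrite lee_fin ler_nat.
by rewrite ltnNge; apply/negP => /ky; rewrite jy eqxx.
Qed.

(** A path from 0 that reaches [x'] has already passed [x], and a visit to [y] would require one to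
    [y'] no later. *)
Lemma hitting_event_antimono n (x x' y y' : int) :
  (forall w, X n 0%N w = 0) ->
  (forall k w, X n k.+1 w - X n k w = 1 \/ X n k.+1 w - X n k w = -1) ->
  0 <= x -> x <= x' -> y <= y' -> y' <= 0 ->
  [set w | (hitting_time R X n x' w < hitting_time R X n y' w)%E] `<=`
  [set w | (hitting_time R X n x w < hitting_time R X n y w)%E].
Proof.
move=> X0 Xs x0 xx' yy' y'0 w /= /hitting_time_ltP[k kx ky].
apply/hitting_time_ltP.
have kx' : x <= X n k w by rewrite kx.
have [j jk jx] := path_crossing_pos (X0 w) (Xs^~ w) x0 kx'.
exists j => // i ij; apply/eqP => iy.
have iy' : X n i w <= y' by rewrite iy.
have [l li ly] := path_crossing_neg (X0 w) (Xs^~ w) y'0 iy'.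
by have /ky := leq_trans li (leq_trans ij jk); rewrite ly eqxx.
Qed.

Lemma process_sigma_algebra_hitting n (x y : int) :
  process_sigma_algebra X n
    [set w | (hitting_time R X n x w < hitting_time R X n y w)%E].
Proof.
pose G := \bigcup_k preimage_set_system setT (X n k) measurable.
have mX k z : measurable ([set w | X n k w = z] : set (g_sigma_algebraType G)).
  apply: sub_sigma_algebra; exists k => //; exists [set z] => //.
  by rewrite setTI.
rewrite (_ : mkset _ = \bigcup_k ([set w | X n k w = x] `&`
    \bigcap_(j in `I_k.+1) ~` [set w | X n j w = y])); last first.
  apply/seteqP; split=> w /=.
    move=> /hitting_time_ltP[k kx ky]; exists k => //; split => // j /= jk.
    by apply/eqP/ky.
  move=> [k _ [kx ky]]; apply/hitting_time_ltP; exists k => // j jk.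
  by apply/eqP; exact: ky.
(* Retyping the carrier as [g_sigma_algebraType G] turns membership in the generated sigma-algebra
   into a [measurable] goal. *)
suff : measurable (\bigcup_k ([set w | X n k w = x] `&`
    \bigcap_(j in `I_k.+1) ~` [set w | X n j w = y])
      : set (g_sigma_algebraType G)) by [].
apply: bigcupT_measurable => k; apply: measurableI; first exact: mX.
apply: bigcap_measurable => [|j _]; first by exists 0%N.
by apply: measurableC; exact: mX.
Qed.

Lemma process_sigma_algebraC n A :
  process_sigma_algebra X n A -> process_sigma_algebra X n (~` A).
Proof. exact: sigma_algebraC. Qed.

Lemma process_sigma_algebra_measurable n A :
  process_sigma_algebra X n A -> measurable A.
Proof.
apply: smallest_sub; first exact: sigma_algebra_measurable.
move=> _ [k _ [B mB <-]]; exact: measurable_funPT.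
Qed.

End hitting_events.

(** * The Markov chain of the right boundary *)

Section boundary_chain.
Context (d : measure_display) (Omega : measurableType d) (R : realType).
Variables (P : probability Omega R) (X : nat -> nat -> {mfun Omega >-> int}).

(** The level [a] is fixed instead of being the random boundary, so the event depends on the single
    process [X n.+1] and independence applies to it. *)
Definition jump_event n (a : nat) : set Omega :=
  [set w | (hitting_time R X n.+1 (a%:Z + 1) w <
            hitting_time R X n.+1 (a%:Z - n%:Z - 1) w)%E].

Definition level_event n (a : nat) : set Omega :=
  [set w | right_boundary R X n w = a%:Z].

Lemma right_boundary_itv n w : 0 <= right_boundary R X n w <= n%:Z.
Proof.
by elim: n => [|n] //=; case: ifP => _ /andP[h1 h2]; apply/andP; split; lia.
Qed.

Lemma level_event_gt n a : (n < a)%N -> level_event n a = set0.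
Proof.
move=> na; apply/seteqP; split=> w //=; rewrite /level_event/=.
by have := right_boundary_itv n w; lia.
Qed.

(** On [level_event n a] the random test in the recursion coincides with [jump_event n a]. Level 0
    has no lower level to be reached from. *)
Lemma level_eventS0 n :
  level_event n.+1 0 = level_event n 0 `&` ~` jump_event n 0.
Proof.
apply/seteqP; split=> w; rewrite /level_event /jump_event/=;
  have := right_boundary_itv n w; case: ifPn => lt.
- by lia.
- by move=> _ h; split=> //; apply/negP; rewrite -h.
- by move=> _ [h]; rewrite -h.
- by move=> _ [].
Qed.

Lemma level_eventSS n a : level_event n.+1 a.+1 =
  (level_event n a `&` jump_event n a) `|`
  (level_event n a.+1 `&` ~` jump_event n a.+1).
Proof.
apply/seteqP; split=> w; rewrite /level_event /jump_event/=;
  have := right_boundary_itv n w; case: ifPn => lt.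
- move=> _ h; left; have h' : right_boundary R X n w = a%:Z by lia.
  by rewrite -h'; split.
- by move=> _ h; right; split=> //; apply/negP; rewrite -h.
- by move=> _ [[h _]|[h]]; [lia|rewrite -h].
- by move=> _ [[h]|[]//]; rewrite -h => /(negP lt).
Qed.

Lemma process_sigma_algebra_jump n a :
  process_sigma_algebra X n.+1 (jump_event n a).
Proof. exact: process_sigma_algebra_hitting. Qed.

Lemma measurable_jump_event n a : measurable (jump_event n a).
Proof.
apply: (@process_sigma_algebra_measurable _ _ X n.+1).
exact: process_sigma_algebra_jump.
Qed.

Lemma measurable_level_event n a : measurable (level_event n a).
Proof.
elim: n a => [|n IH] [|a].
- by rewrite (_ : level_event _ _ = setT)//; apply/seteqP; split.
- by rewrite level_event_gt.
- rewrite level_eventS0; apply: measurableI => //; apply: measurableC.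
  exact: measurable_jump_event.
- rewrite level_eventSS; apply: measurableU; apply: measurableI => //.
    exact: measurable_jump_event.
  by apply: measurableC; exact: measurable_jump_event.
Qed.

Let mW n a : measurable (level_event n a `&` jump_event n a).
Proof.
apply: measurableI; first exact: measurable_level_event.
exact: measurable_jump_event.
Qed.

Let mWC n a : measurable (level_event n a `&` ~` jump_event n a).
Proof.
apply: measurableI; first exact: measurable_level_event.
by apply: measurableC; exact: measurable_jump_event.
Qed.

Lemma level_event_disjoint n a (A B : set Omega) :
  (level_event n a `&` A) `&` (level_event n a.+1 `&` B) = set0.
Proof.
apply/seteqP; split=> // w [[h _] [h' _]].
by move: h'; rewrite /level_event/= h; lia.
Qed.

Hypothesis X_indep : independent_processes P X.

(** Induction on [n]. Quantifying over all finite families of later events lets the induction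
    hypothesis absorb the jump event of process [n.+1] as one more member of the family. *)
Lemma level_event_indep n a (J : {fset nat}) (A : nat -> set Omega) :
  (forall j, j \in J -> (n < j)%N /\ process_sigma_algebra X j (A j)) ->
  (P (level_event n a `&` \bigcap_(j in [set` J]) A j) =
   P (level_event n a) * \prod_(j <- J) P (A j))%E.
Proof.
(* The inductive step for either outcome [W], a jump event or its complement. The hypothesis at [m]
   is used twice: with [W] alone, and with [W] added to the family over [K]. *)
have split1 m b (K : {fset nat}) (B : nat -> set Omega) (W : set Omega) :
  (forall c (J : {fset nat}) (A : nat -> set Omega),
    (forall j, j \in J -> (m < j)%N /\ process_sigma_algebra X j (A j)) ->
    (P (level_event m c `&` \bigcap_(j in [set` J]) A j) =
     P (level_event m c) * \prod_(j <- J) P (A j))%E) ->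
  (forall j, j \in K -> (m.+1 < j)%N /\ process_sigma_algebra X j (B j)) ->
  process_sigma_algebra X m.+1 W ->
  (P ((level_event m b `&` W) `&` \bigcap_(j in [set` K]) B j) =
   P (level_event m b `&` W) * \prod_(j <- K) P (B j))%E.
  move=> IH hB hW.
  have mK : m.+1 \notin K by apply/negP => /hB[]; rewrite ltnn.
  pose B' j := if j == m.+1 then W else B j.
  have B'K j : j \in K -> B' j = B j.
    by move=> jK; rewrite /B'; case: eqP => // jm; rewrite -jm jK in mK.
  have E1 : level_event m b `&` W =
      level_event m b `&` \bigcap_(j in [set` [fset m.+1]%fset]) B' j.
    by rewrite set_fset1 bigcap_set1 /B' eqxx.
  have E2 : (level_event m b `&` W) `&` \bigcap_(j in [set` K]) B j =
      level_event m b `&` \bigcap_(j in [set` (m.+1 |` K)%fset]) B' j.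
    rewrite set_fsetU set_fset1 bigcap_setU bigcap_set1 setIA /B' eqxx.
    congr (_ `&` _); apply: eq_bigcapr => j /= jK.
    by rewrite -/(B' j) B'K.
  rewrite E2 E1 !IH => [|j|j].
  - rewrite big_fsetU1//= big_seq_fset1 muleA /B' eqxx; congr (_ * _)%E.
    by apply: eq_big_seq => j jK; rewrite -/(B' j) B'K.
  - by rewrite inE => /eqP ->; rewrite /B' eqxx.
  - rewrite !inE => /orP[/eqP->|jK]; first by rewrite /B' eqxx.
    by rewrite B'K//; have [/ltnW] := hB _ jK.
elim: n a J A => [|n IH] a J A hA.
  case: a => [|a].
    rewrite (_ : level_event _ _ = setT) ?setTI; last by apply/seteqP; split.
    by rewrite probability_setT mul1e X_indep// => j /hA.
  by rewrite level_event_gt// set0I measure0 mul0e.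
have mA : measurable (\bigcap_(j in [set` J]) A j).
  apply: fin_bigcap_measurable; first exact: finite_fset.
  by move=> j /hA[_]; exact: process_sigma_algebra_measurable.
case: a => [|a].
  rewrite level_eventS0 split1//.
  by apply: process_sigma_algebraC; exact: process_sigma_algebra_jump.
rewrite level_eventSS setIUl measureU//; first last.
- by rewrite setIACA level_event_disjoint set0I.
- exact: measurableI.
- exact: measurableI.
rewrite measureU//; last exact: level_event_disjoint.
rewrite ge0_muleDl//.
congr (_ + _)%E; apply: split1 => //; first exact: process_sigma_algebra_jump.
by apply: process_sigma_algebraC; exact: process_sigma_algebra_jump.
Qed.

Definition boundary_law n a : R := fine (P (level_event n a)).

Definition jump_proba n a : R := fine (P (jump_event n a)).

Lemma boundary_law_ge0 n a : 0 <= boundary_law n a.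
Proof. by rewrite fine_ge0. Qed.

Lemma jump_proba_itv n a : 0 <= jump_proba n a <= 1.
Proof.
rewrite fine_ge0//=; have mw := measurable_jump_event n a.
by rewrite -lee_fin fineK ?fin_num_measure// probability_le1.
Qed.

Lemma boundary_law_gt n a : (n < a)%N -> boundary_law n a = 0.
Proof. by move=> na; rewrite /boundary_law level_event_gt// measure0. Qed.

Let law_indep n a (W : set Omega) : process_sigma_algebra X n.+1 W ->
  fine (P (level_event n a `&` W)) = boundary_law n a * fine (P W).
Proof.
move=> hW; have := @level_event_indep n a [fset n.+1]%fset (fun=> W).
rewrite set_fset1 bigcap_set1 big_seq_fset1 => ->.
  by rewrite fineM// fin_num_measure//;
    [exact: measurable_level_event|exact: process_sigma_algebra_measurable hW].
by move=> j; rewrite inE => /eqP ->.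
Qed.

Let fine_probC n a : fine (P (~` jump_event n a)) = 1 - jump_proba n a.
Proof.
have mw := measurable_jump_event n a.
by rewrite probability_setC// fineB// fin_num_measure.
Qed.

Lemma boundary_lawS0 n :
  boundary_law n.+1 0 = boundary_law n 0 * (1 - jump_proba n 0).
Proof.
rewrite {1}/boundary_law level_eventS0 law_indep ?fine_probC//.
by apply: process_sigma_algebraC; exact: process_sigma_algebra_jump.
Qed.

Lemma boundary_lawSS n a :
  boundary_law n.+1 a.+1 = boundary_law n a * jump_proba n a +
                           boundary_law n a.+1 * (1 - jump_proba n a.+1).
Proof.
rewrite {1}/boundary_law level_eventSS measureU//; last first.
  exact: level_event_disjoint.
rewrite fineD ?fin_num_measure// !law_indep ?fine_probC//.
- by apply: process_sigma_algebraC; exact: process_sigma_algebra_jump.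
- exact: process_sigma_algebra_jump.
Qed.

(** The one-step equation of the chain: from level [a] it moves to [a.+1] with probability
    [jump_proba n a] and otherwise stays. Powers of the positive excess as [phi] give the moment
    recursions. *)
Lemma sum_boundary_lawS n (phi : nat -> R) :
  \sum_(a < n.+2) boundary_law n.+1 a * phi a =
  \sum_(a < n.+1) boundary_law n a *
    (jump_proba n a * phi a.+1 + (1 - jump_proba n a) * phi a).
Proof.
rewrite big_ord_recl boundary_lawS0.
under eq_bigr do rewrite lift0 boundary_lawSS mulrDl.
rewrite big_split/= addrCA.
have -> : \sum_(a < n.+1) boundary_law n a *
    (jump_proba n a * phi a.+1 + (1 - jump_proba n a) * phi a) =
  \sum_(a < n.+1) boundary_law n a * jump_proba n a * phi a.+1 +
  \sum_(a < n.+1) boundary_law n a * (1 - jump_proba n a) * phi a.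
  by rewrite -big_split/=; apply: eq_bigr => a _; ring.
congr (_ + _).
(* The extra last index [n.+1] carries no mass at time [n], which aligns the two shifted sums. *)
rewrite [RHS]big_ord_recl/= big_ord_recr/= (@boundary_law_gt n n.+1)//.
rewrite !mul0r addr0.
by congr (_ + _); apply: eq_bigr.
Qed.

Lemma sum_boundary_law n : \sum_(a < n.+1) boundary_law n a = 1.
Proof.
elim: n => [|n IH].
  rewrite big_ord1 /boundary_law (_ : level_event _ _ = setT).
    by rewrite probability_setT.
  by apply/seteqP; split.
have := sum_boundary_lawS n (fun=> 1).
under eq_bigr do rewrite mulr1.
move=> ->; rewrite -[RHS]IH; apply: eq_bigr => a _; ring.
Qed.

(** Markov's inequality for a finite-valued variable: [phi] dominates the indicator of [Q]. Writing
    the event as a finite union of level events also gives its measurability. *)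
Lemma boundary_ratio_proba_le n (Q : R -> bool) (phi : nat -> R) :
  (forall a, 0 <= phi a) ->
  (forall a : nat, Q ((a%:R + 1) / (n%:R + 2)) -> 1 <= phi a) ->
  measurable [set w | Q (boundary_ratio R X n w)] /\
  (P [set w | Q (boundary_ratio R X n w)] <=
   (\sum_(a < n.+1) boundary_law n a * phi a)%:E)%E.
Proof.
move=> phi0 phi1.
pose F (a : nat) :=
  if Q ((a%:R + 1) / (n%:R + 2)) then level_event n a else set0.
have mF a : measurable (F a).
  by rewrite /F; case: ifP => // _; exact: measurable_level_event.
have EF : [set w | Q (boundary_ratio R X n w)] = \big[setU/set0]_(a < n.+1) F a.
  apply/seteqP; split=> w /=.
    have := right_boundary_itv n w; rewrite /boundary_ratio.
    case E : (right_boundary R X n w) => [a|a]// an Qa.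
    rewrite -bigcup_mkord; exists a => /=; first by lia.
    by rewrite /F Qa.
  rewrite -bigcup_mkord => -[a _]; rewrite /F; case: ifP => // Qa.
  by rewrite /level_event/= /boundary_ratio => ->.
rewrite EF; split; first exact: bigsetU_measurable.
apply: le_trans (Boole_inequality _ (fun i _ => mF i)) _.
rewrite -sumEFin; apply: lee_sum => a _; rewrite /F; case: ifPn => [Qa|_].
  rewrite -[leLHS]fineK ?fin_num_measure//; last exact: measurable_level_event.
  by rewrite lee_fin ler_peMr ?boundary_law_ge0// phi1.
by rewrite measure0 lee_fin mulr_ge0// boundary_law_ge0.
Qed.

End boundary_chain.

(** * Increments of powers of the positive part *)

Section positive_part.
Variable R : realType.
Implicit Types z u : R.

(** For negative [z] the step leaves a positive part of at most 1; otherwise expand the square. The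
    term linear in [u] is kept because its mean will be controlled by the drift. *)
Lemma pos_part_sqr_le z u : -1 <= u <= 1 ->
  Num.max 0 (z + u) ^+ 2 <= Num.max 0 z ^+ 2 + 2 * Num.max 0 z * u + 1.
Proof.
by move=> /andP[u1 u2]; case: (leP 0 (z + u)) => h1; case: (leP 0 z) => h2; nra.
Qed.

Lemma pos_part_pow4_le z u : -1 <= u <= 1 ->
  Num.max 0 (z + u) ^+ 4 <= Num.max 0 z ^+ 4 + 4 * Num.max 0 z ^+ 3 * u +
    8 * Num.max 0 z ^+ 2 + 3.
Proof.
move=> /andP[u1 u2].
have uu : u ^+ 2 <= 1 by nra.
have key y : 0 <= y -> (y + u) ^+ 4 <= y ^+ 4 + 4 * y ^+ 3 * u + 8 * y ^+ 2 + 3.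
  move=> y0; have -> : (y + u) ^+ 4 = y ^+ 4 + 4 * y ^+ 3 * u
      + 6 * (y ^+ 2 * u ^+ 2) + 4 * (y * u) * u ^+ 2 + (u ^+ 2) ^+ 2 by ring.
  (* The coefficients are 8 = 6 + 2 and 3 = 1 + 2: the term cubic in [u] is at most 4 y, hence at
     most 2 y^2 + 2. *)
  have h1 : y ^+ 2 * u ^+ 2 <= y ^+ 2 by rewrite ler_piMr// sqr_ge0.
  have h2 : (u ^+ 2) ^+ 2 <= 1 by rewrite exprn_ile1// sqr_ge0.
  have h3 : 4 * (y * u) * u ^+ 2 <= 4 * y.
    apply: le_trans (_ : 4 * y * u ^+ 2 <= _).
      by rewrite ler_wpM2r ?sqr_ge0//; nra.
    by rewrite ler_piMr//; lra.
  have h4 : 4 * y <= 2 * y ^+ 2 + 2 by have := sqr_ge0 (y - 1); nra.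
  lra.
case: (leP 0 z) => h2.
  case: (leP 0 (z + u)) => h1; first exact: key.
  by rewrite expr0n/=; apply: le_trans (key _ h2); rewrite exprn_even_ge0.
have m1 : Num.max 0 (z + u) <= 1 by rewrite ge_max; apply/andP; split; lra.
have m0 : 0 <= Num.max 0 (z + u) by rewrite le_max lexx.
by have := exprn_ile1 4 m0 m1; rewrite !expr0n/=; lra.
Qed.

End positive_part.

(** * Jump probabilities as values of [hit_proba] *)

Section jump_probabilities.
Context (d : measure_display) (Omega : measurableType d) (R : realType).
Variables (P : probability Omega R) (X : nat -> nat -> {mfun Omega >-> int}).

Lemma boundary_ratio_itv n w : 0 < boundary_ratio R X n w < 1.
Proof.
have /andP[h0 h1] := right_boundary_itv R X n w.
have := h0; rewrite -(ler_int R) => r0.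
have := h1; rewrite -(ler_int R) => r1.
rewrite /boundary_ratio; have n0 : (0 : R) <= n%:R by [].
apply/andP; split; first by rewrite divr_gt0//; lra.
by rewrite ltr_pdivrMr; lra.
Qed.

(* The shift between [n] and [n + 1] in the definitions is absorbed by the
   truncation: with r = (n + 2) x and 0 < x < 1, (n + 3) x = r + x and
   (n + 3) (x - 1) = (r - n - 2) + (x - 1) truncate to r and r - n - 2. *)
Lemma jump_probaE n a : (a <= n)%N ->
  jump_proba P X n a = hit_proba P X n.+1 ((a%:R + 1) / (n%:R + 2)).
Proof.
move=> an; rewrite /jump_proba /hit_proba.
set x : R := (a%:R + 1) / (n%:R + 2).
have n0 : (0 : R) <= n%:R by [].
have an' : (a%:R : R) <= n%:R by rewrite ler_nat.
have a0 : (0 : R) <= a%:R by [].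
have xE : x * (n%:R + 2) = a%:R + 1 by rewrite divfK//; lra.
have x0 : 0 < x by rewrite divr_gt0//; lra.
have x1 : x < 1 by rewrite ltr_pdivrMr; lra.
have nE : (n.+1%:R : R) = n%:R + 1 by rewrite -addn1 natrD.
have -> : truncz ((n.+1%:R + 2) * x) = a%:Z + 1.
  rewrite /truncz ifT; last by rewrite nE; nra.
  by apply: floor_def; rewrite !intrD nE; apply/andP; split; nra.
have -> : truncz ((n.+1%:R + 2) * (x - 1)) = a%:Z - n%:Z - 1.
  rewrite /truncz ifF; last by apply/negbTE; rewrite -ltNge nE; nra.
  by apply: ceil_def; rewrite !(intrB, intrD) nE; apply/andP; split; nra.
by [].
Qed.

(** Increasing the argument moves the right target away from 0 and the left target toward it, and
    truncation preserves both order and sign. *)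
Lemma hit_proba_antimono n (x y : R) :
  (forall w, X n 0%N w = 0) ->
  (forall k w, X n k.+1 w - X n k w = 1 \/ X n k.+1 w - X n k w = -1) ->
  0 <= x -> x <= y -> y <= 1 -> hit_proba P X n y <= hit_proba P X n x.
Proof.
move=> X0 Xs x0 xy y1; rewrite /hit_proba.
have n2 : (0 : R) <= n%:R + 2 by rewrite addr_ge0.
have mE u v : measurable
    [set w | (hitting_time R X n u w < hitting_time R X n v w)%E].
  apply: (@process_sigma_algebra_measurable _ _ X n).
  exact: process_sigma_algebra_hitting.
apply: fine_le; rewrite ?fin_num_measure//.
apply: le_measure; rewrite ?inE//.
apply: hitting_event_antimono => //.
- by rewrite truncz_ge0// mulr_ge0.
- by rewrite le_truncz// ler_wpM2l.
- by rewrite le_truncz// ler_wpM2l// lerB.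
- by rewrite truncz_le0// mulr_ge0_le0// subr_le0.
Qed.

End jump_probabilities.

(** * Moments of the excess and Borel-Cantelli *)

Section one_sided_bound.
Context (d : measure_display) (Omega : measurableType d) (R : realType).
Variables (P : probability Omega R) (X : nat -> nat -> {mfun Omega >-> int}).
Hypothesis X_indep : independent_processes P X.
Variables (s c : R) (N : nat).
Hypotheses (s1 : s = 1 \/ s = -1) (c01 : 0 <= c <= 1).

(** At [a] = d_n this is s (n + 2) (x_n - c); the sign [s] lets one argument give both the upper and
    the lower bound. *)
Definition excess n (a : nat) : R := s * ((a%:R + 1) - c * (n%:R + 2)).

Hypothesis drift : forall n a, (N <= n)%N -> (a <= n)%N -> 0 < excess n a ->
  s * (jump_proba P X n a - c) <= 0.

Definition excess_pos n a : R := Num.max 0 (excess n a).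

Definition moment k n : R :=
  \sum_(a < n.+1) boundary_law P X n a * excess_pos n a ^+ k.

Let moment_ge0 k n : 0 <= moment k n.
Proof.
apply: sumr_ge0 => a _; apply: mulr_ge0; first exact: boundary_law_ge0.
by rewrite exprn_ge0// le_max lexx.
Qed.

Let excessSS n a : excess n.+1 a.+1 = excess n a + s * (1 - c).
Proof. by rewrite /excess -[n.+1]addn1 -[a.+1]addn1 !natrD; ring. Qed.

Let excessS n a : excess n.+1 a = excess n a + s * (- c).
Proof. by rewrite /excess -[n.+1]addn1 !natrD; ring. Qed.

Let step_win : -1 <= s * (1 - c) <= 1.
Proof.
by case: s1 => ->; move: c01 => /andP[? ?]; apply/andP; split; lra.
Qed.

Let step_lose : -1 <= s * (- c) <= 1.
Proof.
by case: s1 => ->; move: c01 => /andP[? ?]; apply/andP; split; lra.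
Qed.

(** The hypothesis [drift] covers only positive excess; elsewhere the factor [excess_pos]
    vanishes. *)
Let drift_pos n a : (N <= n)%N -> (a <= n)%N ->
  excess_pos n a * (s * (jump_proba P X n a - c)) <= 0.
Proof.
move=> Nn an; rewrite /excess_pos.
case: (ltP 0 (excess n a)) => [p0|_]; last by rewrite mul0r.
by rewrite mulr_ge0_le0 ?(ltW p0)//; exact: drift.
Qed.

Lemma moment2S n : (N <= n)%N -> moment 2 n.+1 <= moment 2 n + 1.
Proof.
move=> Nn; rewrite /moment.
rewrite (sum_boundary_lawS X_indep n (fun a => excess_pos n.+1 a ^+ 2)).
rewrite -[X in _ <= _ + X](sum_boundary_law X_indep n) -big_split/=.
apply: ler_sum => a _; rewrite -[X in _ <= _ + X]mulr1 -mulrDr.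
apply: ler_wpM2l; first exact: boundary_law_ge0.
have /andP[g0 g1] := jump_proba_itv P X n a.
have an : (a <= n)%N by rewrite -ltnS.
have dr := drift_pos Nn an.
have := pos_part_sqr_le (excess n a) step_win.
rewrite -excessSS -/(excess_pos _ _).
have := pos_part_sqr_le (excess n a) step_lose.
rewrite -excessS -/(excess_pos _ _).
rewrite -/(excess_pos n a); move: (excess_pos n a) dr => z dr.
move: (excess_pos n.+1 a) (excess_pos n.+1 a.+1) => y x.
move: g0 g1 dr; move: (jump_proba P X n a) => g g0 g1 dr hy hx.
(* Weighting the two outcomes by g and 1 - g, the linear terms add up to 2 z s (g - c), which is
   nonpositive by [dr]. *)
have := ler_wpM2l g0 hx.
have g1' : 0 <= 1 - g by lra.
have := ler_wpM2l g1' hy; lra.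
Qed.

Lemma moment4S n : (N <= n)%N ->
  moment 4 n.+1 <= moment 4 n + 8 * moment 2 n + 3.
Proof.
move=> Nn; rewrite /moment.
rewrite (sum_boundary_lawS X_indep n (fun a => excess_pos n.+1 a ^+ 4)).
rewrite -[X in _ <= _ + X]mulr1.
rewrite -[X in _ <= _ + _ * X](sum_boundary_law X_indep n).
rewrite !mulr_sumr -!big_split/=.
apply: ler_sum => a _.
set q := boundary_law _ _ _ _.
rewrite [leRHS](_ : _ =
  q * (excess_pos n a ^+ 4 + 8 * excess_pos n a ^+ 2 + 3)); last by ring.
apply: ler_wpM2l; first exact: boundary_law_ge0.
have /andP[g0 g1] := jump_proba_itv P X n a.
have an : (a <= n)%N by rewrite -ltnS.
have dr := drift_pos Nn an.
have := pos_part_pow4_le (excess n a) step_win.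
rewrite -excessSS -/(excess_pos _ _).
have := pos_part_pow4_le (excess n a) step_lose.
rewrite -excessS -/(excess_pos _ _).
rewrite -/(excess_pos n a); move: (excess_pos n a) dr => z dr.
move: (excess_pos n.+1 a) (excess_pos n.+1 a.+1) => y x.
move: g0 g1 dr; move: (jump_proba P X n a) => g g0 g1 dr hy hx.
have := ler_wpM2l g0 hx.
have g1' : 0 <= 1 - g by lra.
have := ler_wpM2l g1' hy.
have : z ^+ 2 * (z * (s * (g - c))) <= 0 by rewrite mulr_ge0_le0// sqr_ge0.
rewrite mulrA -exprSr; lra.
Qed.

Lemma moment2_le n : moment 2 (N + n) <= moment 2 N + n%:R.
Proof.
elim: n => [|n IH]; first by rewrite addn0 addr0.
rewrite addnS (le_trans (moment2S _)) ?leq_addr//.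
by rewrite -[n.+1]addn1 natrD addrA lerD2r.
Qed.

Lemma moment4_le n :
  moment 4 (N + n) <= (moment 4 N + 8 * moment 2 N + 11) * (n%:R + 1) ^+ 2.
Proof.
have m2 := moment_ge0 2 N; have m4 := moment_ge0 4 N.
(* Summing [moment4S] with the linear bound on the second moment gives a quadratic in [n]; the
   constant 11 is 3 + 8. *)
suff : moment 4 (N + n) <=
    moment 4 N + (8 * moment 2 N + 3) * n%:R + 8 * n%:R ^+ 2.
  move=> /le_trans; apply; have n0 : (0 : R) <= n%:R by [].
  by have := mulr_ge0 m4 n0; have := mulr_ge0 m2 n0; nra.
elim: n => [|n IH]; first by rewrite addn0 expr0n/= !mulr0 !addr0.
rewrite addnS (le_trans (moment4S _)) ?leq_addr//.
have := moment2_le n; have n0 : (0 : R) <= n%:R by [].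
rewrite -[n.+1]addn1 natrD; nra.
Qed.

Variables (e : R) (e0 : 0 < e).

(** A fourth moment of order n^2 against a threshold of order n to the fourth power leaves order 1 /
    n^2, written as a difference so that the sum telescopes. *)
Lemma proba_exceed_le n :
  measurable [set w | e <= s * (boundary_ratio R X (N + n)%N w - c)] /\
  (P [set w | (e <= s * (boundary_ratio R X (N + n)%N w - c))%R] <=
   ((moment 4 N + 8 * moment 2 N + 11) / e ^+ 4 *
    ((n%:R + 1)^-1 - (n%:R + 2)^-1))%:E)%E.
Proof.
set m := (N + n)%N; have n0 : (0 : R) <= n%:R by [].
have nm : (n%:R : R) <= m%:R by rewrite ler_nat leq_addl.
have em : 0 < e * (m%:R + 2) by rewrite mulr_gt0//; lra.
pose phi a := (excess_pos m a / (e * (m%:R + 2))) ^+ 4.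
have [|a|meas le] := @boundary_ratio_proba_le _ _ _ P X m
    (fun x => e <= s * (x - c)) phi.
- by move=> a; rewrite exprn_even_ge0.
- move=> ea; rewrite /phi exprn_ege1// ler_pdivlMr// mul1r /excess_pos le_max.
  apply/orP; right; rewrite /excess.
  have -> : s * (a%:R + 1 - c * (m%:R + 2)) =
      s * ((a%:R + 1) / (m%:R + 2) - c) * (m%:R + 2) by field; lra.
  by rewrite ler_wpM2r//; lra.
split => //; apply: le_trans le _; rewrite lee_fin.
have -> : \sum_(a < m.+1) boundary_law P X m a * phi a =
    moment 4 m / (e * (m%:R + 2)) ^+ 4.
  rewrite /moment mulr_suml; apply: eq_bigr => a _.
  by rewrite /phi expr_div_n mulrA.
set K := _ + 11.
have K0 : 0 <= K.
  by have := moment_ge0 2 N; have := moment_ge0 4 N; rewrite /K; lra.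
rewrite ler_pdivrMr ?exprn_gt0//.
apply: le_trans (moment4_le n) _; rewrite -/K.
rewrite exprMn -!mulrA ler_wpM2l//.
have -> : (n%:R + 1)^-1 - (n%:R + 2)^-1 = (n%:R + 1)^-1 * (n%:R + 2)^-1 :> R.
  by field; lra.
rewrite [leRHS](_ : _ =
  (m%:R + 2) ^+ 4 / ((n%:R + 1) * (n%:R + 2))); last first.
  by field; rewrite !gt_eqF//; lra.
rewrite ler_pdivlMr; last by apply: mulr_gt0; lra.
(* What remains is (n + 1)^3 (n + 2) <= (m + 2)^4, with n <= m. *)
apply: le_trans (_ : (n%:R + 2) ^+ 4 <= _); first by nra.
by rewrite lerXn2r// ?nnegrE; lra.
Qed.

Lemma ae_eventually_not_exceed :
  {ae P, forall w, \forall n \near \oo, s * (boundary_ratio R X n w - c) < e}.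
Proof.
pose F n := [set w | e <= s * (boundary_ratio R X (N + n)%N w - c)].
have mF n : measurable (F n) by have [] := proba_exceed_le n.
(* The exceptional set is that of infinitely many exceedances; it is null because the telescoping
   bounds sum to at most [K]. *)
exists (lim_sup_set F); split.
- by apply: bigcap_measurable => [|k _]; [exists 0%N|apply: bigcup_measurable].
- apply: lim_sup_set_cvg0 => //.
  set K := (moment 4 N + 8 * moment 2 N + 11) / e ^+ 4.
  apply: le_lt_trans (ltry K).
  apply: lime_le; first exact: is_cvg_nneseries.
  apply: nearW => n; apply: le_trans.
    by apply: lee_sum => i _; have [_] := proba_exceed_le i; apply.
  rewrite sumEFin lee_fin -mulr_sumr -/K.
  have K0 : 0 <= K.
    rewrite divr_ge0// ?exprn_even_ge0//.
    by have := moment_ge0 2 N; have := moment_ge0 4 N; lra.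
  have -> : \sum_(0 <= i < n) ((i%:R + 1)^-1 - (i%:R + 2)^-1) =
      1 - (n%:R + 1)^-1 :> R.
    elim: n => [|n IH]; first by rewrite big_geq// add0r invr1 subrr.
    rewrite big_nat_recr//= IH -[n.+1]addn1 natrD.
    by rewrite addrA addrNK (_ : n%:R + 1%:R + 1 = n%:R + 2 :> R)//; ring.
  by rewrite ler_piMr// gerBl invr_ge0 addr_ge0.
- move=> w /= nw k _; apply: contrapT => nF; apply: nw.
  exists (N + k)%N => // n /= Nkn; rewrite ltNge; apply/negP => en.
  have Nn := leq_trans (leq_addr k N) Nkn.
  apply: nF; exists (n - N)%N => /=; first by rewrite leq_subRL.
  by rewrite /F/= subnKC.
Qed.

End one_sided_bound.

(** * Crossing of a nonincreasing function with the diagonal *)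

Section fixed_point_of_nonincreasing.
Variables (R : realType) (h : R -> R).
Hypothesis h01 : forall x : R, 0 <= x <= 1 -> 0 <= h x <= 1.
Hypothesis h_anti : forall x y : R, 0 <= x -> x <= y -> y <= 1 -> h y <= h x.

Lemma is_cvg_left_nonincreasing01 (q : R) : 0 < q -> q <= 1 ->
  cvg (h x @[x --> q^'-]).
Proof.
move=> q0 q1; rewrite -(opprK h); apply: is_cvgN.
apply: nondecreasing_at_left_is_cvgr.
  near=> s => x y; rewrite !in_itv/= => /andP[sx xq] /andP[sy yq] xy.
  have s0 : 0 < s by near: s; exact: nbhs_left_gt.
  by rewrite lerN2 h_anti//; lra.
near=> s; exists 0 => _ /= [x /[!in_itv]/= /andP[sx xq] <-].
have s0 : 0 < s by near: s; exact: nbhs_left_gt.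
by rewrite oppr_le0; have /h01/andP[] : 0 <= x <= 1 by apply/andP; split; lra.
Unshelve. all: by end_near. Qed.

Lemma is_cvg_right_nonincreasing01 (q : R) : 0 <= q -> q < 1 ->
  cvg (h x @[x --> q^'+]).
Proof.
move=> q0 q1; apply: nonincreasing_at_right_is_cvgr.
  near=> s => x y; rewrite !in_itv/= => /andP[sx xq] /andP[sy yq] xy.
  have s1 : s < 1 by near: s; exact: nbhs_right_lt.
  by rewrite h_anti//; lra.
near=> s; exists 1 => _ /= [x /[!in_itv]/= /andP[sx xq] <-].
have s1 : s < 1 by near: s; exact: nbhs_right_lt.
by have /h01/andP[] : 0 <= x <= 1 by apply/andP; split; lra.
Unshelve. all: by end_near. Qed.

Lemma left_limit01_le (m q : R) : 0 <= m -> m < q -> q <= 1 ->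
  left_limit01 h q <= h m.
Proof.
move=> m0 mq q1; rewrite /left_limit01 gt_eqF; last by lra.
apply: limr_le; first by apply: is_cvg_left_nonincreasing01 => //; lra.
near=> x; have mx : m < x by near: x; exact: nbhs_left_gt.
have xq : x < q by near: x; exact: nbhs_left_lt.
by rewrite h_anti//; lra.
Unshelve. all: by end_near. Qed.

Lemma right_limit01_ge (m q : R) : 0 <= q -> q < m -> m <= 1 ->
  h m <= right_limit01 h q.
Proof.
move=> q0 qm m1; rewrite /right_limit01 lt_eqF; last by lra.
apply: limr_ge; first by apply: is_cvg_right_nonincreasing01 => //; lra.
near=> x; have mx : x < m by near: x; exact: nbhs_right_lt.
have xq : q < x by near: x; exact: nbhs_right_gt.
by rewrite h_anti//; lra.
Unshelve. all: by end_near. Qed.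

(** Take the supremum of the x with x <= h x. Below it, some y in this set exceeds x, and x < y <= h
    y <= h x; above it, membership fails. *)
Lemma nonincreasing01_crossing : exists p : R,
  [/\ 0 <= p <= 1,
      forall x, 0 <= x -> x < p -> x < h x &
      forall x, p < x -> x <= 1 -> h x < x].
Proof.
pose S := [set x : R | 0 <= x <= 1 /\ x <= h x].
have S0 : S 0.
  have z01 : 0 <= (0 : R) <= 1 by rewrite lexx ler01.
  by split=> //; have /andP[] := h01 z01.
have ubS : ubound S 1 by move=> x [/andP[]].
have hubS : has_ubound S by exists 1.
have p0 : 0 <= sup S by exact: ub_le_sup.
exists (sup S); split.
- by rewrite p0 ge_sup//; exists 0.
- move=> x x0 /(sup_gt (ex_intro _ 0 S0))[y [/andP[y0 y1] yh] xy].
  exact: lt_le_trans xy (le_trans yh (h_anti x0 (ltW xy) y1)).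
- move=> x px x1; rewrite ltNge; apply/negP => xh.
  have : S x by split=> //; rewrite x1 andbT; lra.
  by move/(ub_le_sup hubS); rewrite leNgt px.
Qed.

Lemma left_limit01_crossing (p : R) : 0 <= p <= 1 ->
  (forall x, 0 <= x -> x < p -> x < h x) -> p <= left_limit01 h p.
Proof.
move=> /andP[p0 p1] hp; rewrite /left_limit01; case: eqP => [->|/eqP pn0].
  by have /h01/andP[] : 0 <= (0 : R) <= 1 by rewrite lexx ler01.
have {}p0 : 0 < p by rewrite lt_def pn0.
have cvgid : x @[x --> p^'-] --> p by apply: cvg_at_left_filter; exact: cvg_id.
apply: (ler_cvg_to cvgid); first exact: is_cvg_left_nonincreasing01.
near=> x; apply/ltW/hp; last by near: x; exact: nbhs_left_lt.
by near: x; exact: nbhs_left_ge.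
Unshelve. all: by end_near. Qed.

Lemma right_limit01_crossing (p : R) : 0 <= p <= 1 ->
  (forall x, p < x -> x <= 1 -> h x < x) -> right_limit01 h p <= p.
Proof.
move=> /andP[p0 p1] hp; rewrite /right_limit01; case: eqP => [->|/eqP pn1].
  by have /h01/andP[] : 0 <= (1 : R) <= 1 by rewrite lexx ler01.
have {}p1 : p < 1 by rewrite lt_neqAle pn1.
have cvgid : x @[x --> p^'+] --> p by apply: cvg_at_right_filter; exact: cvg_id.
apply: (ler_cvg_to _ cvgid); first exact: is_cvg_right_nonincreasing01.
near=> x; apply/ltW/hp; first by near: x; exact: nbhs_right_gt.
by near: x; exact: nbhs_right_le.
Unshelve. all: by end_near. Qed.

(** The midpoint m of p and q gives a contradiction: m < h m <= h(q+) <= q < m if q < p, and m < q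
    <= h(q-) <= h m < m if p < q. *)
Lemma crossing_unique (p q : R) : 0 <= p <= 1 ->
  (forall x, 0 <= x -> x < p -> x < h x) ->
  (forall x, p < x -> x <= 1 -> h x < x) ->
  0 <= q <= 1 -> q <= left_limit01 h q -> right_limit01 h q <= q -> q = p.
Proof.
move=> /andP[p0 p1] hl hr /andP[q0 q1] ql qr.
have [qp|pq|//] := ltgtP q p.
- have [m0 qm mp] : [/\ 0 <= (p + q) / 2, q < (p + q) / 2 & (p + q) / 2 < p].
    by split; lra.
  by have := hl _ m0 mp; have := @right_limit01_ge ((p + q) / 2) q q0 qm; lra.
- have [m0 qm mp] : [/\ 0 <= (p + q) / 2, (p + q) / 2 < q & p < (p + q) / 2].
    by split; lra.
  by have := hr _ mp; have := @left_limit01_le ((p + q) / 2) q m0 qm; lra.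
Qed.

End fixed_point_of_nonincreasing.

(** * Almost sure convergence to the crossing point *)

Theorem theorem2p1 (d : measure_display) (Omega : measurableType d)
    (R : realType) (P : probability Omega R)
    (X : nat -> nat -> {mfun Omega >-> int}) (h : R -> R)
    (X_indep : independent_processes P X)
    (X_start : forall (n : nat) (w : Omega), (1 <= n)%N -> X n 0%N w = 0)
    (X_step : forall (n k : nat) (w : Omega), (1 <= n)%N ->
       X n k.+1 w - X n k w = 1 \/ X n k.+1 w - X n k w = -1)
    (X_infinite : forall n : nat, (1 <= n)%N ->
       {ae P, forall w, infinite_set (range (fun k => X n k w))})
    (h01 : forall x : R, 0 <= x <= 1 -> 0 <= h x <= 1)
    (h_lim : forall x : R, 0 <= x <= 1 ->
       hit_proba P X n x @[n --> \oo] --> h x) :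
  exists p : R,
    [/\ 0 <= p <= 1,
        {ae P, forall w, boundary_ratio R X n w @[n --> \oo] --> p},
        left_limit01 h p >= p /\ p >= right_limit01 h p
      & forall q : R, 0 <= q <= 1 ->
          left_limit01 h q >= q /\ q >= right_limit01 h q -> q = p].
Proof.
have anti n (x y : R) : (1 <= n)%N -> 0 <= x -> x <= y -> y <= 1 ->
    hit_proba P X n y <= hit_proba P X n x.
  move=> n1; apply: hit_proba_antimono => [w|k w]; first exact: X_start.
  exact: X_step.
have h_anti (x y : R) : 0 <= x -> x <= y -> y <= 1 -> h y <= h x.
  move=> x0 xy y1.
  have hx := h_lim x; have hy := h_lim y.
  apply: (ler_cvg_to (hy _) (hx _)); [by apply/andP; split; lra..|].
  by near=> n; apply: anti => //; near: n; exact: nbhs_infty_ge.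
have [p [p01 hl hr]] := nonincreasing01_crossing h01 h_anti.
exists p; split => //; last 2 first.
- by split; [exact: left_limit01_crossing|exact: right_limit01_crossing].
- by move=> q q01 [ql qr]; exact: (crossing_unique h01 h_anti p01 hl hr).
have /andP[p0 p1] := p01.
(* With the ratio named [x], the excess factors as s (x - c) (n + 2), so its sign is that of s (x -
   c). *)
have jumpE n a : (a <= n)%N ->
  exists2 x : R, 0 < x < 1 /\ a%:R + 1 = x * (n%:R + 2) &
    jump_proba P X n a = hit_proba P X n.+1 x.
  move=> an; exists ((a%:R + 1) / (n%:R + 2)); last exact: jump_probaE.
  have n0 : (0 : R) <= n%:R by [].
  have an' : (a%:R : R) <= n%:R by rewrite ler_nat.
  have a0 : (0 : R) <= a%:R by [].
  split; last by rewrite divfK//; lra.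
  by rewrite divr_gt0 ?ltr_pdivrMr//; lra.
have upper (e : R) : 0 < e ->
    {ae P, forall w, \forall n \near \oo, boundary_ratio R X n w < p + e}.
  (* The choice c = p + e / 2 gives h(c) < c and leaves a margin e / 2. If c >= 1 the bound is
     trivial, as the ratio stays below 1. *)
  move=> e0; have [pe|pe] := leP 1 (p + e / 2).
    apply: aeW => w; apply: nearW => n.
    by have /andP[_] := boundary_ratio_itv R X n w; lra.
  have c01 : 0 <= p + e / 2 <= 1 by apply/andP; split; lra.
  have hc : h (p + e / 2) < p + e / 2 by apply: hr; lra.
  have [N _ hN] := cvgr_le _ (h_lim _ c01) _ hc.
  have e2 : 0 < e / 2 by lra.
  apply: filterS (ae_eventually_not_exceed X_indep (s := 1) (N := N)
    (or_introl erefl) c01 _ e2) => [w|n a Nn an].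
    by apply: filterS => n; rewrite mul1r; lra.
  have n2 : (0 : R) < n%:R + 2 by rewrite ltr_wpDl.
  rewrite /excess; have [x [/andP[x0 x1] ->] ->] := jumpE _ _ an.
  rewrite !mul1r -mulrBl.
  (* Positive excess means c < x, so by monotonicity the bound [hit_proba] <= c, valid at c from
     rank [N] on, carries over to x. *)
  rewrite pmulr_lgt0// subr_gt0 => cx.
  have := anti n.+1 _ _ isT (proj1 (andP c01)) (ltW cx) (ltW x1).
  by have /= := hN n.+1 (leq_trans Nn (leqnSn _)); lra.
have lower (e : R) : 0 < e ->
    {ae P, forall w, \forall n \near \oo, p - e < boundary_ratio R X n w}.
  move=> e0; have [pe|pe] := leP (p - e / 2) 0.
    apply: aeW => w; apply: nearW => n.
    by have /andP[+ _] := boundary_ratio_itv R X n w; lra.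
  have c01 : 0 <= p - e / 2 <= 1 by apply/andP; split; lra.
  have hc : p - e / 2 < h (p - e / 2) by apply: hl; lra.
  have [N _ hN] := cvgr_ge _ (h_lim _ c01) _ hc.
  have e2 : 0 < e / 2 by lra.
  apply: filterS (ae_eventually_not_exceed X_indep (s := -1) (N := N)
    (or_intror erefl) c01 _ e2) => [w|n a Nn an].
    by apply: filterS => n; rewrite mulN1r; lra.
  have n2 : (0 : R) < n%:R + 2 by rewrite ltr_wpDl.
  rewrite /excess; have [x [/andP[x0 x1] ->] ->] := jumpE _ _ an.
  (* For s = -1 positive excess means x < c, and monotonicity gives a jump probability of at least
     c. *)
  rewrite !mulN1r -mulrBl oppr_gt0 pmulr_llt0// subr_lt0 => cx.
  have := anti n.+1 _ _ isT (ltW x0) (ltW cx) (proj2 (andP c01)).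
  by have /= := hN n.+1 (leq_trans Nn (leqnSn _)); lra.
(* Margins 1 / (k + 1) suffice and leave only countably many almost sure events to intersect. *)
have inv0 k : (0 : R) < k.+1%:R^-1 by rewrite invr_gt0.
have := ae_foralln (fun k => upper _ (inv0 k)).
have := ae_foralln (fun k => lower _ (inv0 k)).
apply: filterS2 => w low up; apply/cvgrPdist_lt => /= e e0.
have [k _ /(_ k (leqnn k))/= ke] := near_infty_natSinv_lt (PosNum e0).
near=> n; rewrite ltr_norml.
have : p - k.+1%:R^-1 < boundary_ratio R X n w by near: n; exact: low.
have : boundary_ratio R X n w < p + k.+1%:R^-1 by near: n; exact: up.
move: ke; move: (k.+1%:R^-1) => t ke h1 h2; apply/andP; split; lra.
Unshelve. all: by end_near. Qed.
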